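(* Let $n\ge1$. For every set of formulas $\Gamma$ and formula $\varphi$, $\Gamma\vdash_{\mathrm{LP}_n}\varphi$ if and only if there exist $k\ge1$ and formulas $\psi_1,\dots,\psi_k$ such that $\alpha(\psi_1,\dots,\psi_k),\ \{\gamma\wedge\alpha(\psi_1,\dots,\psi_k):\gamma\in\Gamma\}\vdash_{\mathrm{BD}_n}\varphi$, where $\alpha(\psi_1,\dots,\psi_k)=(\psi_1\vee\neg\psi_1)\wedge\dots\wedge(\psi_k\vee\neg\psi_k)$. The same equivalence holds with $\mathrm{LP}_\infty$ and $\mathrm{BD}_\infty$ in place of $\mathrm{LP}_n$ and $\mathrm{BD}_n$.
   Context: Formulas are built from variables using $\wedge,\vee,\neg$. A structure is a pair $\langle\mathbf{A},F\rangle$, $F\subseteq A$; a rule $\Gamma\vdash\varphi$ is valid in it if every homomorphism $v$ from the formula algebra with $v[\Gamma]\subseteq F$ has $v(\varphi)\in F$. A logic is a substitution-invariant consequence relation; the extension of a logic by rules is the smallest logic containing it and the rules. $\mathrm{BD}_\infty$ is the logic determined by all structures $\langle\mathbf{A},F\rangle$ with $\mathbf{A}$ a De~Morgan lattice (distributive lattice with $\neg$ satisfying $\neg\neg x=x$ and the De~Morgan laws) and $F$ an upset. $\mathrm{LP}_\infty$ is the extension of $\mathrm{BD}_\infty$ by $\emptyset\vdash x\vee\neg x$ and $x\vdash x\wedge(y\vee\neg y)$. $\mathrm{BD}_n$ and $\mathrm{LP}_n$ are the extensions of $\mathrm{BD}_\infty$ and $\mathrm{LP}_\infty$ by the $n$-adjunction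 rule $\{\bigwedge_{j\ne i}x_j:1\le i\le n+1\}\vdash x_1\wedge\dots\wedge x_{n+1}$. *)

(* Defs.v *)
From HB Require Import structures.
From mathcomp Require Import all_boot all_order.
From mathcomp Require Import boolp classical_sets.

Set Implicit Arguments.
Unset Strict Implicit.
Unset Printing Implicit Defensive.

Local Open Scope classical_set_scope.

Inductive formula : Type :=
  | Var of nat
  | And of formula & formula
  | Or of formula & formula
  | Neg of formula.

Fixpoint subst (s : nat -> formula) (phi : formula) : formula :=
  match phi with
  | Var x => s x
  | And a b => And (subst s a) (subst s b)
  | Or a b => Or (subst s a) (subst s b)
  | Neg a => Neg (subst s a)
  end.

(* Left-nested conjunction of a nonempty list. The value on [::] is arbitrary
   and is never reached from the rules and formulas below when 1 <= n and
   1 <= k. *)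
Definition bigAnd (s : seq formula) : formula :=
  if s is phi :: s' then foldl And phi s' else Var 0.

(* No lattice bounds are required. *)
Record deMorganLattice := DeMorganLattice {
  dml_disp : Order.disp_t;
  dml_sort :> distrLatticeType dml_disp;
  dml_neg : dml_sort -> dml_sort;
  dml_negK : forall x, dml_neg (dml_neg x) = x;
  dml_negI : forall x y,
    dml_neg (Order.meet x y) = Order.join (dml_neg x) (dml_neg y);
  dml_negU : forall x y,
    dml_neg (Order.join x y) = Order.meet (dml_neg x) (dml_neg y)
}.

Record is_hom (A : deMorganLattice) (v : formula -> A) : Prop := IsHom {
  hom_and : forall a b, v (And a b) = Order.meet (v a) (v b);
  hom_or : forall a b, v (Or a b) = Order.join (v a) (v b);
  hom_neg : forall a, v (Neg a) = dml_neg (v a)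
}.

(* The empty set and the whole lattice count as upsets. *)
Definition upset (A : deMorganLattice) (F : set A) : Prop :=
  forall x y : A, (x <= y)%O -> F x -> F y.

Definition valid (A : deMorganLattice) (F : set A)
    (Gamma : set formula) (phi : formula) : Prop :=
  forall v : formula -> A, is_hom v -> v @` Gamma `<=` F -> F (v phi).

Definition consequence := set formula -> formula -> Prop.

Record is_logic (L : consequence) : Prop := IsLogic {
  logic_refl : forall (Gamma : set formula) phi, Gamma phi -> L Gamma phi;
  logic_mono : forall (Gamma Delta : set formula) phi,
    Gamma `<=` Delta -> L Gamma phi -> L Delta phi;
  logic_cut : forall (Gamma Delta : set formula) phi,
    (forall delta, Delta delta -> L Gamma delta) -> L Delta phi -> L Gamma phi;
  logic_subst : forall (s : nat -> formula) (Gamma : set formula) phi,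
    L Gamma phi -> L (subst s @` Gamma) (subst s phi)
}.

Definition rule : Type := set formula * formula.

(* The smallest logic containing L and the rules in R, as the intersection of
   all such logics. *)
Definition extension (L : consequence) (R : set rule) : consequence :=
  fun Gamma phi => forall L' : consequence,
    is_logic L' ->
    (forall Delta psi, L Delta psi -> L' Delta psi) ->
    (forall r, R r -> L' r.1 r.2) ->
    L' Gamma phi.

Definition BDoo : consequence := fun Gamma phi =>
  forall (A : deMorganLattice) (F : set A), upset F -> valid F Gamma phi.

Definition em (phi : formula) : formula := Or phi (Neg phi).

Definition LPoo : consequence :=
  extension BDoo
    [set (set0, em (Var 0)); ([set Var 0], And (Var 0) (em (Var 1)))].

(* The variables x_1, ..., x_(n+1) are Var 0, ..., Var n. *)
Definition adjunction (n : nat) : rule :=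
  (range (fun i : 'I_n.+1 =>
      bigAnd [seq Var j | j <- iota 0 n.+1 & j != i :> nat]),
   bigAnd [seq Var j | j <- iota 0 n.+1]).

Definition BD (n : nat) : consequence := extension BDoo [set adjunction n].

Definition LP (n : nat) : consequence := extension LPoo [set adjunction n].

Definition alpha (psi : seq formula) : formula :=
  bigAnd [seq em p | p <- psi].

(* Main.v *)
Require Import Defs.
From HB Require Import structures.
From mathcomp Require Import all_boot all_order generic_quotient.
From mathcomp Require Import boolp classical_sets cardinality.

(** A rule of BDoo holds exactly when its conclusion lies above one of its
    premises in the free De Morgan lattice.  Hence BDoo, and with it every BD n,
    is finitary; moreover both are closed under conjoining one formula to all
    premises and to the conclusion.  For such a logic L, the relation "some
    alpha psi can be conjoined to the premises so that L derives phi" is a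
    logic: in the cut, finitarity leaves finitely many tuples psi, which are
    concatenated.  It satisfies the two rules defining LPoo, and it is contained
    in every logic above L that does. *)

Set Implicit Arguments.
Unset Strict Implicit.
Unset Printing Implicit Defensive.

Import Order.Theory.

Local Open Scope classical_set_scope.
Local Open Scope quotient_scope.

HB.instance Definition _ := gen_eqMixin formula.
HB.instance Definition _ := gen_choiceMixin formula.

(** * The free De Morgan lattice *)

Definition entails (a b : formula) : Prop :=
  forall (A : deMorganLattice) (v : formula -> A), is_hom v -> (v a <= v b)%O.

Lemma entails_trans a b c : entails a b -> entails b c -> entails a c.
Proof. by move=> ab bc A v hv; exact: le_trans (ab A v hv) (bc A v hv). Qed.

Definition dm_equiv (a b : formula) : bool :=
  `[< forall (A : deMorganLattice) (v : formula -> A), is_hom v -> v a = v b >].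

Lemma dm_equiv_is_equiv : equiv_class_of dm_equiv.
Proof.
split=> [a|a b|b a c].
- exact/asboolP.
- by apply/asboolP/asboolP => ab A v hv; rewrite ab.
- by move=> /asboolP ab /asboolP bc; apply/asboolP => A v hv; rewrite ab // bc.
Qed.

Canonical dm_equivRel := EquivRelPack dm_equiv_is_equiv.

Definition freeDM : Type := {eq_quot dm_equivRel}.

HB.instance Definition _ := Choice.on freeDM.
HB.instance Definition _ := EqQuotient.on freeDM.

Lemma freeDM_eqP (a b : formula) :
  (forall (A : deMorganLattice) (v : formula -> A), is_hom v -> v a = v b) <->
  \pi_freeDM a = \pi_freeDM b.
Proof.
split=> [ab|/eqquotP/asboolP//].
by apply/eqquotP/asboolP.
Qed.

(** Homomorphisms identify equivalent formulas, so the representative picked by [repr] does not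
    affect values. *)
Lemma hom_repr (A : deMorganLattice) (v : formula -> A) (a : formula) :
  is_hom v -> v (repr (\pi_freeDM a)) = v a.
Proof.
by move=> hv; apply: (iffRL (freeDM_eqP _ _) _ A v hv); rewrite reprK.
Qed.

Definition free_meet (x y : freeDM) : freeDM :=
  \pi_freeDM (And (repr x) (repr y)).
Definition free_join (x y : freeDM) : freeDM :=
  \pi_freeDM (Or (repr x) (repr y)).
Definition free_neg (x : freeDM) : freeDM := \pi_freeDM (Neg (repr x)).

Lemma pi_And a b :
  \pi_freeDM (And a b) = free_meet (\pi_freeDM a) (\pi_freeDM b).
Proof. by apply/freeDM_eqP => A v hv; rewrite !(hom_and hv) !hom_repr. Qed.

Lemma pi_Or a b : \pi_freeDM (Or a b) = free_join (\pi_freeDM a) (\pi_freeDM b).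
Proof. by apply/freeDM_eqP => A v hv; rewrite !(hom_or hv) !hom_repr. Qed.

Lemma pi_Neg a : \pi_freeDM (Neg a) = free_neg (\pi_freeDM a).
Proof. by apply/freeDM_eqP => A v hv; rewrite !(hom_neg hv) !hom_repr. Qed.

(** Lifts classes to formulas and evaluates both sides under an arbitrary homomorphism, which leaves
    the same identity in an arbitrary De Morgan lattice. *)
Ltac free_identity :=
  repeat (elim/quotW => ?); apply/freeDM_eqP => ? ?; let hv := fresh in intro hv;
  rewrite !(hom_and hv, hom_or hv, hom_neg hv, hom_repr _ hv).

Lemma free_meetC : commutative free_meet.
Proof. by free_identity; rewrite meetC. Qed.

Lemma free_joinC : commutative free_join.
Proof. by free_identity; rewrite joinC. Qed.

Lemma free_meetA : associative free_meet.
Proof. by free_identity; rewrite meetA. Qed.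

Lemma free_joinA : associative free_join.
Proof. by free_identity; rewrite joinA. Qed.

Lemma free_joinKI (y x : freeDM) : free_meet x (free_join x y) = x.
Proof. by move: y x; free_identity; rewrite joinKI. Qed.

Lemma free_meetKU (y x : freeDM) : free_join x (free_meet x y) = x.
Proof. by move: y x; free_identity; rewrite meetKU. Qed.

Lemma free_meetUl : left_distributive free_meet free_join.
Proof. by free_identity; rewrite meetUl. Qed.

Lemma free_meetxx : idempotent_op free_meet.
Proof. by free_identity; rewrite meetxx. Qed.

Lemma free_negK (x : freeDM) : free_neg (free_neg x) = x.
Proof. by move: x; free_identity; rewrite dml_negK. Qed.

Lemma free_negI (x y : freeDM) :
  free_neg (free_meet x y) = free_join (free_neg x) (free_neg y).
Proof. by move: x y; free_identity; rewrite dml_negI. Qed.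

Lemma free_negU (x y : freeDM) :
  free_neg (free_join x y) = free_meet (free_neg x) (free_neg y).
Proof. by move: x y; free_identity; rewrite dml_negU. Qed.

Fact freeDM_display : Order.disp_t. Proof. exact: (Order.Disp tt tt). Qed.

HB.instance Definition _ :=
  @Order.isMeetJoinDistrLattice.Build freeDM_display freeDM
    (fun x y => free_meet x y == x)
    (fun x y => (y != x) && (free_meet x y == x))
    free_meet free_join (fun _ _ => erefl) (fun _ _ => erefl)
    free_meetC free_joinC free_meetA free_joinA free_joinKI free_meetKU
    free_meetUl free_meetxx.

Definition freeDML : deMorganLattice :=
  @DeMorganLattice freeDM_display freeDM free_neg free_negK free_negI free_negU.

Lemma pi_is_hom : is_hom (fun a => \pi_freeDM a : freeDML).
Proof. by split; [exact: pi_And|exact: pi_Or|exact: pi_Neg]. Qed.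

(** The order on the quotient is the equation $x \wedge y = x$ between classes, and such an equation
    transfers to every De Morgan lattice. *)
Lemma le_free (a b : formula) :
  (\pi_freeDM a <= \pi_freeDM b :> freeDML)%O -> entails a b.
Proof.
move=> /eqP; rewrite -pi_And => /freeDM_eqP ab A v hv.
by apply/meet_idPl; rewrite -(hom_and hv) ab.
Qed.

(** Test the rule on the free lattice with the upset generated by the classes of the premises. An
    element of this upset lies above the class of a single premise. *)
Lemma BDooP (Gamma : set formula) (phi : formula) :
  BDoo Gamma phi <-> exists2 gamma, Gamma gamma & entails gamma phi.
Proof.
split=> [Gphi|[g Gg gphi] A F upF v hv vGF]; last first.
  by apply: upF (gphi A v hv) _; apply: vGF; exists g.
pose F : set freeDML :=
  [set x | exists2 g, Gamma g & (\pi_freeDM g <= x :> freeDML)%O].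
have upF : upset F.
  by move=> x y xy [g Gg gx]; exists g => //; exact: le_trans gx xy.
have [|g Gg /le_free gphi] := Gphi _ F upF _ pi_is_hom; last by exists g.
by move=> _ [g Gg <-]; exists g.
Qed.

(** * Conjunctions and substitutions *)

(** Describing [bigAnd] by its lower bounds makes the nesting irrelevant: entailments between
    conjunctions become statements about [all]. *)
Lemma le_hom_bigAnd (A : deMorganLattice) (v : formula -> A) (x : A)
    (s : seq formula) : is_hom v -> (0 < size s)%N ->
  (x <= v (bigAnd s))%O = all (fun a => x <= v a)%O s.
Proof.
case: s => // a s hv _ /=.
elim: s a => [|b s IHs] a /=; first by rewrite andbT.
by rewrite IHs (hom_and hv) lexI andbA.
Qed.

Lemma size_map_gt0 (T U : Type) (f : T -> U) (s : seq T) :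
  (0 < size s)%N -> (0 < size (map f s))%N.
Proof. by rewrite size_map. Qed.

Lemma size_cat_gt0 (T : Type) (s t : seq T) :
  (0 < size s)%N -> (0 < size (s ++ t))%N.
Proof. by case: s. Qed.

Lemma alpha_cat (s t : seq formula) : (0 < size s)%N -> (0 < size t)%N ->
  entails (alpha (s ++ t)) (alpha s) /\ entails (alpha (s ++ t)) (alpha t).
Proof.
move=> s0 t0; split=> A v hv; set x := v (alpha (s ++ t));
  have : (x <= v (bigAnd _))%O := lexx x;
  rewrite !le_hom_bigAnd ?size_map_gt0 ?size_cat_gt0 //;
  by rewrite map_cat all_cat => /andP[].
Qed.

Lemma subst_bigAnd (sigma : nat -> formula) (s : seq formula) :
  (0 < size s)%N -> subst sigma (bigAnd s) = bigAnd [seq subst sigma a | a <- s].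
Proof. by case: s => //= a s _; elim: s a => //= b s IHs a; rewrite IHs. Qed.

Lemma subst_alpha (sigma : nat -> formula) (s : seq formula) :
  (0 < size s)%N -> subst sigma (alpha s) = alpha [seq subst sigma a | a <- s].
Proof.
move=> s0; rewrite /alpha subst_bigAnd ?size_map_gt0 //.
by rewrite -!map_comp.
Qed.

Lemma subst_comp (sigma tau : nat -> formula) (a : formula) :
  subst sigma (subst tau a) = subst (subst sigma \o tau) a.
Proof. by elim: a => //= [a -> b ->|a -> b ->|a ->]. Qed.

Lemma subst_Var (a : formula) : subst Var a = a.
Proof. by elim: a => //= [a -> b ->|a -> b ->|a ->]. Qed.

Lemma subst_is_hom (sigma : nat -> formula) (A : deMorganLattice)
    (v : formula -> A) : is_hom v -> is_hom (v \o subst sigma).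
Proof.
by move=> hv; split=> * /=; rewrite ?(hom_and hv, hom_or hv, hom_neg hv).
Qed.

Lemma entails_subst (sigma : nat -> formula) (a b : formula) :
  entails a b -> entails (subst sigma a) (subst sigma b).
Proof. by move=> ab A v hv; exact: (ab A _ (subst_is_hom sigma hv)). Qed.

Lemma entails_Andl (a b : formula) : entails (And a b) a.
Proof. by move=> A v hv; rewrite (hom_and hv) leIl. Qed.

Lemma entails_Andr (a b : formula) : entails (And a b) b.
Proof. by move=> A v hv; rewrite (hom_and hv) leIr. Qed.

Lemma entails_And (a b c : formula) :
  entails a b -> entails a c -> entails a (And b c).
Proof. by move=> ab ac A v hv; rewrite (hom_and hv) lexI ab // ac. Qed.

Lemma entails_And2 (a b c d : formula) :
  entails a b -> entails c d -> entails (And a c) (And b d).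
Proof.
move=> ab cd; apply: entails_And.
  exact: entails_trans (@entails_Andl _ _) ab.
exact: entails_trans (@entails_Andr _ _) cd.
Qed.

Lemma entails_subst_And (sigma : nat -> formula) (chi : formula) (J : seq nat) :
  (0 < size J)%N ->
  let tau j := And (sigma j) chi in
  let c := bigAnd [seq Var j | j <- J] in
  entails (And (subst sigma c) chi) (subst tau c) /\
  entails (subst tau c) (And (subst sigma c) chi).
Proof.
move=> J0 tau c; rewrite !subst_bigAnd ?size_map_gt0 //; split=> A v hv.
  rewrite le_hom_bigAnd ?size_map_gt0 // all_map all_map.
  have := lexx (v (bigAnd [seq subst sigma a | a <- [seq Var j | j <- J]])).
  rewrite {1}le_hom_bigAnd ?size_map_gt0 // all_map all_map.
  by apply: sub_all => j /= lej; rewrite !(hom_and hv); exact: leI2.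
set x := v _; have : (x <= v _)%O := lexx x.
rewrite le_hom_bigAnd ?size_map_gt0 // all_map all_map => xJ.
rewrite (hom_and hv) lexI le_hom_bigAnd ?size_map_gt0 // all_map all_map.
apply/andP; split.
  by apply: sub_all xJ => j /=; rewrite (hom_and hv) lexI => /andP[].
(* Any one conjunct [tau j] already lies below [chi]; [J] is nonempty, so its head will do. *)
case: (J) J0 xJ => //= j J' _ /andP[+ _].
by rewrite (hom_and hv) lexI => /andP[].
Qed.

(** * Extensions of logics *)

Definition contains_BDoo (L : consequence) : Prop :=
  forall Gamma phi, BDoo Gamma phi -> L Gamma phi.

Lemma entails_logic (L : consequence) (Gamma : set formula) (a b : formula) :
  is_logic L -> contains_BDoo L -> entails a b -> L Gamma a -> L Gamma b.
Proof.
move=> logL BL ab La; apply: (logic_cut logL (Delta := [set a])).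
  by move=> _ ->.
by apply/BL/BDooP; exists a.
Qed.

Lemma BDoo_logic : is_logic BDoo.
Proof.
split=> [G phi Gphi|G D phi GD|G D phi GD|sigma G phi].
- by apply/BDooP; exists phi => // A v hv.
- by move=> /BDooP[g Gg gphi]; apply/BDooP; exists g => //; exact: GD.
- move=> /BDooP[d /GD/BDooP[g Gg gd] dphi]; apply/BDooP; exists g => //.
  exact: entails_trans gd dphi.
- move=> /BDooP[g Gg gphi]; apply/BDooP; exists (subst sigma g).
    by exists g.
  exact: entails_subst.
Qed.

Lemma extension_logic (L : consequence) (R : set rule) :
  is_logic (extension L R).
Proof.
split=> [G phi Gphi|G D phi GD Gphi|G D phi GD Dphi|sigma G phi Gphi] L' logL'
  LL' RL'.
- exact: logic_refl.
- by apply: logic_mono GD _ => //; exact: Gphi.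
- apply: logic_cut (Dphi L' logL' LL' RL') => // d Dd.
  exact: GD.
- by apply: logic_subst => //; exact: Gphi.
Qed.

Lemma sub_extension (L : consequence) (R : set rule) Gamma phi :
  L Gamma phi -> extension L R Gamma phi.
Proof. by move=> Lphi L' logL' LL' _; exact: LL'. Qed.

Lemma rule_extension (L : consequence) (R : set rule) (r : rule) :
  R r -> extension L R r.1 r.2.
Proof. by move=> Rr L' _ _; exact. Qed.

Definition finitary (L : consequence) : Prop :=
  forall Gamma phi, L Gamma phi ->
  exists D : set formula, [/\ finite_set D, D `<=` Gamma & L D phi].

Lemma BDoo_finitary : finitary BDoo.
Proof.
move=> G phi /BDooP[g Gg gphi]; exists [set g]; split=> //.
  by move=> _ ->.
by apply/BDooP; exists g.
Qed.

(** By minimality of the extension, it suffices that derivability from a finite subset of the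
    premises is a logic containing [L] and the rules. *)
Lemma extension_finitary (L : consequence) (R : set rule) :
  finitary L -> (forall r, R r -> finite_set r.1) -> finitary (extension L R).
Proof.
move=> finL finR G phi /(_ (fun G phi => exists D : set formula,
  [/\ finite_set D, D `<=` G & extension L R D phi])).
have logE := extension_logic L R.
apply=> [|{}G {}phi /finL[D [finD DG Dphi]]|r Rr]; last 2 first.
- by exists D; split=> //; exact: sub_extension.
- by exists r.1; split=> //; [exact: finR|exact: rule_extension].
split=> {G phi}[G phi Gphi|G D phi GD [E [finE EG Ephi]]|
    G D phi GD [E [finE ED Ephi]]|sigma G phi [E [finE EG Ephi]]].
- by exists [set phi]; split=> // [_ ->//|]; exact: (logic_refl logE).
- by exists E; split=> //; exact: subset_trans EG GD.
(* Cut: choose a finite set of premises for each of the finitely many [d] in [E], and take their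
   union. *)
- have /choice[f fP] : forall d, exists X : set formula,
      E d -> [/\ finite_set X, X `<=` G & extension L R X d].
    move=> d; have [Ed|nEd] := pselect (E d); last by exists set0.
    by have [X XP] := GD _ (ED _ Ed); exists X.
  exists (\bigcup_(d in E) f d); split.
  + by apply: bigcup_finite => // d /fP[].
  + by move=> x [d /fP[_ + _]]; exact.
  + apply: logic_cut Ephi => // d Ed; have [_ _] := fP d Ed.
    by apply: logic_mono => // x fx; exists d.
- exists (subst sigma @` E); split.
  + exact: finite_image.
  + exact: image_subset.
  + exact: (logic_subst logE).
Qed.

Definition And_stable (L : consequence) : Prop :=
  forall Gamma phi chi,
  L Gamma phi -> L [set And gamma chi | gamma in Gamma] (And phi chi).

Lemma BDoo_And_stable : And_stable BDoo.
Proof.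
move=> G phi chi /BDooP[g Gg gphi]; apply/BDooP; exists (And g chi).
  by exists g.
exact: entails_And2.
Qed.

(** Again by minimality: the rules that remain derivable after any substitution and any conjoined
    formula form a logic, so only the new rules have to be checked. *)
Lemma extension_And_stable (L : consequence) (R : set rule) :
  is_logic L -> And_stable L ->
  (forall r sigma chi, R r -> extension L R
     [set And (subst sigma gamma) chi | gamma in r.1]
     (And (subst sigma r.2) chi)) ->
  And_stable (extension L R).
Proof.
move=> logL staL staR G phi chi Gphi.
have logE := extension_logic L R.
(* The extra substitution makes the relation below substitution invariant:
   chi need not be a substitution instance. *)
suff : forall sigma chi, extension L R
    [set And (subst sigma gamma) chi | gamma in G] (And (subst sigma phi) chi).
  move=> /(_ Var chi); rewrite subst_Var; congr (extension _ _ _ _).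
  by apply: eq_imagel => g _; rewrite subst_Var.
apply: (Gphi (fun G phi => forall sigma chi, extension L R
  [set And (subst sigma gamma) chi | gamma in G] (And (subst sigma phi) chi)))
  => {G phi chi Gphi}; last by move=> r Rr sigma chi; exact: staR.
  split=> [G phi Gphi sigma chi|G D phi GD Gphi sigma chi|
      G D phi GD Dphi sigma chi|tau G phi Gphi sigma chi].
  - by apply: (logic_refl logE); exists phi.
  - by apply: (logic_mono logE) (Gphi sigma chi) => _ [g /GD Dg <-]; exists g.
  - by apply: (logic_cut logE) (Dphi sigma chi) => _ [d /GD Gd <-].
  - rewrite subst_comp; apply: (logic_mono logE) (Gphi _ chi) => _ [g Gg <-].
    exists (subst tau g); first by exists g.
    by rewrite subst_comp.
move=> G phi Gphi sigma chi; apply: sub_extension.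
rewrite -(image_comp (subst sigma) (fun g => And g chi)).
exact/staL/(logic_subst logL).
Qed.

Lemma BD_logic n : is_logic (BD n).
Proof. exact: extension_logic. Qed.

Lemma BD_contains_BDoo n : contains_BDoo (BD n).
Proof. by move=> G phi; exact: sub_extension. Qed.

Lemma BD_finitary n : finitary (BD n).
Proof.
apply: extension_finitary BDoo_finitary _ => _ ->.
exact: finite_image.
Qed.

(** Instantiate $n$-adjunction at [sigma j] conjoined with [chi]. Since [chi] can be pulled out of
    nonempty conjunctions, this instance is the required rule up to equivalence. *)
Lemma BD_And_stable n : (1 <= n)%N -> And_stable (BD n).
Proof.
move=> n1; apply: extension_And_stable BDoo_logic BDoo_And_stable _.
move=> _ sigma chi ->; rewrite -/(BD n).
have logB := BD_logic n; have BB := @BD_contains_BDoo n.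
pose tau j := And (sigma j) chi.
apply: (entails_logic logB BB) (_ : BD n _ (subst tau (adjunction n).2)).
  by have [] := @entails_subst_And sigma chi (iota 0 n.+1) isT.
have adj : BD n (adjunction n).1 (adjunction n).2 by exact: rule_extension.
apply: logic_cut (logic_subst logB tau adj) => //.
move=> _ [_ [i _ <-] <-].
(* A premise omits one of $n+1\ge 2$ indices, so index 0 or index 1 survives; for $n=0$ it would be
   the default value of [bigAnd]. *)
have J0 : (0 < size [seq j <- iota 0 n.+1 | j != i :> nat])%N.
  rewrite size_filter -has_count; apply/hasP.
  exists (if i == 0 :> nat then 1%N else 0%N); rewrite ?mem_iota.
    by case: ifP.
  by case: (nat_of_ord i).
have [lei _] := entails_subst_And sigma chi J0.
apply: (entails_logic logB BB lei); apply: (logic_refl logB).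
by eexists; first by exists i.
Qed.

(** * Adding excluded middles to the premises *)

(** The separate premise [chi] matters when [Gamma] is empty, since [BDoo] derives nothing from no
    premises. *)
Definition relativized (chi : formula) (Gamma : set formula) : set formula :=
  [set chi] `|` [set And gamma chi | gamma in Gamma].

(** Nonempty lists replace the tuples of the theorem because the cut concatenates them. *)
Definition em_closure (L : consequence) : consequence := fun Gamma phi =>
  exists s : seq formula, (0 < size s)%N /\ L (relativized (alpha s) Gamma) phi.

Lemma em_closureP (L : consequence) Gamma phi :
  em_closure L Gamma phi <->
  exists (k : nat) (psi : k.-tuple formula), (1 <= k)%N /\
    L ([set alpha psi] `|` [set And gamma (alpha psi) | gamma in Gamma]) phi.
Proof.
split=> [[s [s0 Lphi]]|[k [psi [k1 Lphi]]]].
  by exists (size s), (in_tuple s).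
by exists psi; split; rewrite ?size_tuple.
Qed.

Section EmClosure.
Variable L : consequence.
Hypotheses (logL : is_logic L) (BL : contains_BDoo L).
Hypotheses (finL : finitary L) (staL : And_stable L).

Lemma sub_em_closure Gamma phi : L Gamma phi -> em_closure L Gamma phi.
Proof.
move=> Lphi; exists [:: Var 0]; split=> //.
apply: logic_cut Lphi => // g Gg.
apply: (entails_logic logL BL (@entails_Andl g (alpha [:: Var 0]))).
by apply: (logic_refl logL); right; exists g.
Qed.

Lemma relativized_And (chi chi' psi a : formula) (Gamma : set formula) :
  L (relativized psi Gamma) a -> entails chi psi -> entails chi chi' ->
  L (relativized chi Gamma) (And a chi').
Proof.
move=> La chipsi chichi'.
apply: (entails_logic logL BL (@entails_And2 a a chi chi' _ chichi')).
  by move=> A v hv.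
apply: logic_cut (staL chi La) => // _ [p + <-].
have idchi : entails chi chi by move=> A v hv.
move=> [->|[g Gg <-]].
  apply: (entails_logic logL BL (entails_And chipsi idchi)).
  by apply: (logic_refl logL); left.
apply: (entails_logic logL BL (_ : entails (And g chi) _)); last first.
  by apply: (logic_refl logL); right; exists g.
by apply: entails_And (@entails_Andr _ _); apply: entails_And2.
Qed.

Lemma em_closure_cut (Gamma Delta : set formula) phi :
  (forall delta, Delta delta -> em_closure L Gamma delta) ->
  em_closure L Delta phi -> em_closure L Gamma phi.
Proof.
move=> GD [s [s0 /finL[D [/finite_seqP[l ->] lD Lphi]]]].
(* Quantifying over every [chi] below [alpha t] keeps the derivations already found valid when [t]
   is lengthened in the induction. *)
suff [t [t0 [_ tl]]] : exists t, (0 < size t)%N /\ entails (alpha t) (alpha s) /\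
    forall chi d, d \in l -> entails chi (alpha t) -> L (relativized chi Gamma) d.
  exists t; split=> //; apply: logic_cut Lphi => // d dl.
  by apply: tl => // A v hv.
elim: l lD {Lphi} => [_|d l IHl lD]; first by exists s; split=> //; split.
have [|t [t0 [ts tl]]] := IHl.
  by move=> x xl; apply: lD; rewrite /= inE; apply/orP; right.
(* The new premise is either [alpha s], for which [t] suffices, or some [delta] conjoined with
   [alpha s], for which the list [u] of [delta] is put in front of [t]. *)
have [|->|[delta /GD[u [u0 Lu]] <-]] := lD d.
- by rewrite /= inE eqxx.
- exists t; split=> //; split=> // chi e; rewrite inE => /orP[/eqP->|/tl].
    move=> chit; apply: (entails_logic logL BL (entails_trans chit ts)).
    by apply: (logic_refl logL); left.
  exact.
have [ut_u ut_t] := alpha_cat u0 t0.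
exists (u ++ t); split; first exact: size_cat_gt0.
split=> [|chi e]; first exact: entails_trans ut_t ts.
rewrite inE => /orP[/eqP->|/tl el] chiut; last first.
  exact/el/(entails_trans chiut).
apply: relativized_And Lu (entails_trans chiut ut_u) _.
exact: entails_trans (entails_trans chiut ut_t) ts.
Qed.

Lemma em_closure_logic : is_logic (em_closure L).
Proof.
split=> [G phi Gphi|G D phi GD [s [s0 Lphi]]||sigma G phi [s [s0 Lphi]]].
- by apply: sub_em_closure; exact: logic_refl.
- exists s; split=> //; apply: logic_mono Lphi => //.
  by apply: setUS; exact: image_subset.
- exact: em_closure_cut.
- exists [seq subst sigma a | a <- s]; split; first exact: size_map_gt0.
  apply: (logic_mono logL) (logic_subst logL sigma Lphi).
  rewrite -subst_alpha // => _ [_ [->|[g Gg <-]] <-]; first by left.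
  by right; exists (subst sigma g) => //; exists g.
Qed.

Lemma LPoo_sub_em_closure Gamma phi :
  LPoo Gamma phi -> em_closure L Gamma phi.
Proof.
apply; first exact: em_closure_logic.
  by move=> D psi Dpsi; exact/sub_em_closure/BL.
(* Both conclusions become premises: [em (Var 0)] is [alpha [:: Var 0]], and the second one is
   [Var 0] conjoined with [alpha [:: Var 1]]. *)
move=> _ [->|->].
  by exists [:: Var 0]; split=> //; apply: (logic_refl logL); left.
exists [:: Var 1]; split=> //.
by apply: (logic_refl logL); right; exists (Var 0).
Qed.

(** Above [LPoo], excluded middles are theorems and can be conjoined one by one to any derived
    formula, so [Gamma] yields all relativized premises. *)
Lemma em_closure_sub (L' : consequence) Gamma phi :
  is_logic L' -> (forall D psi, L D psi -> L' D psi) ->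
  (forall D psi, LPoo D psi -> L' D psi) ->
  em_closure L Gamma phi -> L' Gamma phi.
Proof.
move=> logL' LL' LPL' [s [s0 Lphi]].
have BL' : contains_BDoo L' by move=> D psi /BL/LL'.
have em0 D a : L' D (em a).
  have /(logic_subst logL' (fun=> a)) : L' set0 (em (Var 0)).
    by apply: LPL'; apply: (@rule_extension _ _ (set0, _)); left.
  by rewrite image_set0; apply: logic_mono.
have emA D a b : L' D a -> L' D (And a (em b)).
  move=> Da; have : L' [set Var 0] (And (Var 0) (em (Var 1))).
    by apply: LPL'; apply: (@rule_extension _ _ ([set _], _)); right.
  move=> /(logic_subst logL' (fun j => if j is 0 then a else b)).
  by rewrite image_set1; apply: logic_cut => // _ ->.
have emAs D a t : L' D a -> L' D (foldl And a [seq em p | p <- t]).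
  by elim: t a => //= b t IHt a Da; exact/IHt/emA.
apply: logic_cut (LL' _ _ Lphi) => // _ [->|[g Gg <-]].
  by case: s s0 {Lphi} => //= b s _; exact: emAs.
(* This conjunction nests to the left starting from [g]; it is regrouped as [g] conjoined with
   [alpha s]. *)
have := emAs Gamma g s (logic_refl logL' Gg).
apply: entails_logic => // A v hv.
have := lexx (v (bigAnd (g :: [seq em p | p <- s]))).
rewrite {1}le_hom_bigAnd //= => /andP[leg les].
by rewrite (hom_and hv) lexI leg le_hom_bigAnd ?size_map_gt0.
Qed.

End EmClosure.

Theorem mainTheorem10 :
  (forall n : nat, (1 <= n)%N ->
    forall (Gamma : set formula) (phi : formula),
      LP n Gamma phi <->
      exists (k : nat) (psi : k.-tuple formula), (1 <= k)%N /\
        BD n ([set alpha psi] `|` [set And gamma (alpha psi) | gamma in Gamma])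
             phi) /\
  (forall (Gamma : set formula) (phi : formula),
      LPoo Gamma phi <->
      exists (k : nat) (psi : k.-tuple formula), (1 <= k)%N /\
        BDoo ([set alpha psi] `|` [set And gamma (alpha psi) | gamma in Gamma])
             phi).
Proof.
split=> [n n1 Gamma phi|Gamma phi]; rewrite -em_closureP; split.
- have logB := BD_logic n; have BB := @BD_contains_BDoo n.
  have finB := @BD_finitary n; have staB := BD_And_stable n1.
  (* [LP n] is an intersection of logics, and [em_closure (BD n)] is one of them. *)
  apply; first exact: em_closure_logic.
    exact: LPoo_sub_em_closure.
  by move=> r Rr; apply: sub_em_closure => //; exact: rule_extension.
- apply: em_closure_sub => [|||D psi].
  + exact: BD_contains_BDoo.
  + exact: extension_logic.
  (* [BD n] lies in [LP n] by minimality, as [LP n] contains [BDoo] through [LPoo] and has the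
     adjunction rule. *)
  + move=> D psi; apply; first exact: extension_logic.
      by move=> E chi BE; do 2!apply: sub_extension.
    by move=> r Rr; exact: rule_extension.
  + exact: sub_extension.
- apply: LPoo_sub_em_closure => //.
  + exact: BDoo_logic.
  + exact: BDoo_finitary.
  + exact: BDoo_And_stable.
- apply: em_closure_sub => //.
  + exact: extension_logic.
  + by move=> D psi; exact: sub_extension.
Qed.
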